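(* Let $\bar\Gamma$ be a topological network with boundary $\partial\Gamma$ and $\Gamma=\bar\Gamma\setminus\partial\Gamma$, and let $H$ and $H_n$, $n\in\mathbb N$, be Hamiltonians of eikonal type on $\bar\Gamma$. Assume $H_n(x,p)\to H(x,p)$ uniformly for $n\to\infty$, i.e. $H_n^j(\pi_j^{-1}(x),p)\to H^j(\pi_j^{-1}(x),p)$ uniformly for $(x,p)\in\bar e_j\times\mathbb R$ for any $j\in J$. For any $n\in\mathbb N$ let $u_n$ be a (viscosity) solution of $H_n(x,Du)=0$, $x\in\Gamma$, and assume $u_n\to u$ uniformly in $\Gamma$ for $n\to\infty$. Then $u$ is a (viscosity) solution of $H(x,Du)=0$, $x\in\Gamma$.
   Context: Topological network. Let $V=\{v_i: i\in I\}$ be a finite set of pairwise different points of $\mathbb R^N$ and let $\{\pi_j: j\in J\}$ be a finite collection of differentiable, non self-intersecting curves $\pi_j:[0,l_j]\to\mathbb R^N$, $l_j>0$. Put $e_j=\pi_j((0,l_j))$, $\bar e_j=\pi_j([0,l_j])$. Assume: (i) $\pi_j(0),\pi_j(l_j)\in V$ for all $j$; (ii) $\#(\bar e_j\cap V)=2$ for all $j$; (iii) $\bar e_j\cap\bar e_k\subset V$ and $\#(\bar e_j\cap\bar e_k)\le 1$ for $j\ne k$; (iv) any two $v,w\in V$ are joined by a finite sequence of edges in which consecutive edges satisfy $\#(\bar e\cap\bar e')=1$, $v$ belongs to the first closed edge and $w$ to the last. Then $\bar\Gamma=\bigcup_j\bar e_j$ is a topological network, with the subspace topology of $\mathbb R^N$.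 Let $Inc_i=\{j\in J: v_i\in\bar e_j\}$, and $a_{ij}=1$ if $\pi_j(0)=v_i$, $a_{ij}=-1$ if $\pi_j(l_j)=v_i$, $a_{ij}=0$ otherwise. A nonempty set $I_B\subset I$ is given, always with $i\in I_B$ whenever $\#(Inc_i)=1$; $\partial\Gamma=\{v_i:i\in I_B\}$ (boundary vertices), $I_T=I\setminus I_B$ (indices of transition vertices), $\Gamma=\bar\Gamma\setminus\partial\Gamma$. For a function $u$ on the network, $u^j=u\circ\pi_j$, and $\partial_j u(x)$ is the derivative of $u^j$ at $\pi_j^{-1}(x)$ (for $x\in\bar e_j$; one-sided at vertices). Hamiltonian of eikonal type: a collection $H=(H^j)_{j\in J}$, $H^j:[0,l_j]\times\mathbb R\to\mathbb R$, such that: $H^j$ is continuous; $p\mapsto H^j(x,p)$ is convex for every $x\in[0,l_j]$; $H^j(x,p)\to+\infty$ as $|p|\to\infty$ for every $x\in[0,l_j]$; $H^j(\pi_j^{-1}(v_i),p)=H^k(\pi_k^{-1}(v_i),p)$ for all $p\in\mathbb R$, $i\in I$, $j,k\in Inc_i$; $H^j(\pi_j^{-1}(v_i),p)=H^j(\pi_j^{-1}(v_i),-p)$ for all $p\in\mathbb R$, $i\in I$, $j\in Inc_i$. For $x\in\bar e_j$ write $H^j(x,\partial_j\phi(x)):=H^j(\pi_j^{-1}(x),\partial_j\phi(x))$. Differentiability: $\phi\in C(\Gamma)$ is differentiable at $x\in e_j$ if $\phi^j$ is differentiable at $\pi_j^{-1}(x)$. At $x=v_i$, $i\in I_T$, for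 $j,k\in Inc_i$, $j\neq k$, $\phi$ is $(j,k)$-differentiable at $x$ if $\partial_j\phi(x),\partial_k\phi(x)$ exist and $a_{ij}\partial_j\phi(x)+a_{ik}\partial_k\phi(x)=0$. Viscosity solutions. Subsolution conditions for $u$ in $\Gamma$: for every $x\in e_j$, $j\in J$, and every $\phi\in C(\Gamma)$ differentiable at $x$ such that $u-\phi$ has a local maximum at $x$, $H^j(x,\partial_j\phi(x))\le 0$; and for every $x=v_i$, $i\in I_T$, every $j,k\in Inc_i$, $j\ne k$, and every $\phi\in C(\Gamma)$ that is $(j,k)$-differentiable at $x$ and such that $u-\phi$ has a local maximum at $x$, $H^j(x,\partial_j\phi(x))\le 0$. Supersolution conditions for $u$ in $\Gamma$: for every $x\in e_j$, $j\in J$, and every $\phi\in C(\Gamma)$ differentiable at $x$ such that $u-\phi$ has a local minimum at $x$, $H^j(x,\partial_j\phi(x))\ge 0$; and for every $x=v_i$, $i\in I_T$, and every $j\in Inc_i$ there exists $k\in Inc_i$, $k\ne j$, such that for every $\phi\in C(\Gamma)$ that is $(j,k)$-differentiable at $x$ and such that $u-\phi$ has a local minimum at $x$, $H^j(x,\partial_j\phi(x))\ge 0$. A (viscosity) solution of $H(x,Du)=0$ in $\Gamma$ is a function $u\in C(\Gamma)$ satisfying both the subsolution and the supersolution conditions in $\Gamma$. *)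

(* Defs.v *)
From mathcomp Require Import all_boot all_order all_algebra.
From mathcomp Require Import all_classical all_reals all_analysis.
Import Order.TTheory GRing.Theory Num.Theory.
Import numFieldNormedType.Exports.

Set Implicit Arguments.
Unset Strict Implicit.
Unset Printing Implicit Defensive.

Local Open Scope classical_set_scope.
Local Open Scope ring_scope.
Local Open Scope card_scope.

(* Derivative relative to a set [A]: the difference quotient is only taken
   along points of [A], so at an endpoint of a segment it is one-sided. *)
Section relative_derivative.
Context {R : realType} {W : normedModType R}.
Implicit Types (A : set R) (f : R -> W) (t : R).

Definition diff_quotient f t (s : R) : W := (s - t)^-1 *: (f s - f t).

Definition derivable_in A f t : Prop :=
  cvg (diff_quotient f t s @[s --> within A t^']).

Definition derive_in A f t : W :=
  lim (diff_quotient f t s @[s --> within A t^']).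

End relative_derivative.

(* [curve j] only matters on [`[0, len j]]. In [net_connected] the sequence of
   edges is [j :: s], hence nonempty. *)
Record network (R : realType) (N : nat) (I J : finType) := Network {
  vertex : I -> 'rV[R]_N ;
  len : J -> R ;
  curve : J -> R -> 'rV[R]_N ;
  bdry : set I ;
  open_edge := fun j : J => curve j @` `]0, len j[ ;
  closed_edge := fun j : J => curve j @` `[0, len j] ;
  incident := fun i : I => [set j | closed_edge j (vertex i)] ;
  net_vertex_inj : injective vertex ;
  net_len_gt0 : forall j, 0 < len j ;
  net_curve_derivable : forall j t, t \in `[0, len j] ->
    derivable_in `[0, len j] (curve j) t ;
  net_curve_inj : forall j, {in `[0, len j] &, injective (curve j)} ;
  net_curve_ends : forall j,
    range vertex (curve j 0) /\ range vertex (curve j (len j)) ;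
  net_edge_vertices : forall j, closed_edge j `&` range vertex #= `I_2 ;
  net_edges_meet : forall j k, j <> k ->
    closed_edge j `&` closed_edge k `<=` range vertex /\
    closed_edge j `&` closed_edge k #<= `I_1 ;
  net_connected : forall v w, range vertex v -> range vertex w ->
    exists (j : J) (s : seq J),
      [/\ path (fun k k' => `[< closed_edge k `&` closed_edge k' #= `I_1 >]) j s,
          closed_edge j v & closed_edge (last j s) w] ;
  net_bdry_neq0 : bdry !=set0 ;
  net_bdry_ends : forall i, incident i #= `I_1 -> bdry i
}.

Section network_theory.
Context {R : realType} {N : nat} {I J : finType} (G : network R N I J).
Local Notation point := 'rV[R]_N.

Definition net_closure : set point := \bigcup_j closed_edge G j.

Definition net_boundary : set point := vertex G @` bdry G.

Definition net_interior : set point := net_closure `\` net_boundary.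

Definition transition : set I := ~` bdry G.

Definition incidence (i : I) (j : J) : R :=
  if curve G j 0 == vertex G i then 1
  else if curve G j (len G j) == vertex G i then -1 else 0.

(* The inverse of the parametrization, meaningful on [closed_edge G j]. *)
Definition param (j : J) : point -> R :=
  'pinv_(fun=> 0) `[0, len G j] (curve G j).

(* Functions on the network are total functions on the ambient space whose
   values off the network are irrelevant. *)
Implicit Types (u phi : point -> R) (H : J -> R -> R -> R).

Definition edge_derivable (j : J) phi (x : point) : Prop :=
  derivable_in `[0, len G j] (phi \o curve G j : R -> R) (param j x).

Definition edge_derive (j : J) phi (x : point) : R :=
  derive_in `[0, len G j] (phi \o curve G j : R -> R) (param j x).

Definition jk_differentiable (i : I) (j k : J) phi : Prop :=
  [/\ edge_derivable j phi (vertex G i), edge_derivable k phi (vertex G i) &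
      incidence i j * edge_derive j phi (vertex G i) +
      incidence i k * edge_derive k phi (vertex G i) = 0].

Definition continuous_net u : Prop := {within net_interior, continuous u}.

Definition net_local_max u (x : point) : Prop :=
  \forall y \near within net_interior (nbhs x), u y <= u x.

Definition net_local_min u (x : point) : Prop :=
  \forall y \near within net_interior (nbhs x), u x <= u y.

Definition eikonal_type H : Prop :=
  [/\ forall j, {within `[0, len G j] `*` setT,
        continuous (fun z : R * R => H j z.1 z.2)},
      forall j t, t \in `[0, len G j] ->
        convex_function (setT : set R^o) (H j t),
      forall j t, t \in `[0, len G j] ->
        H j t p @[p --> +oo] --> +oo /\ H j t p @[p --> -oo] --> +oo,
      forall i j k p, incident G i j -> incident G i k ->
        H j (param j (vertex G i)) p = H k (param k (vertex G i)) p &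
      forall i j p, incident G i j ->
        H j (param j (vertex G i)) p = H j (param j (vertex G i)) (- p)].

Definition subsolution_cond H u : Prop :=
  (forall j x phi, open_edge G j x -> continuous_net phi ->
     edge_derivable j phi x -> net_local_max (u \- phi) x ->
     H j (param j x) (edge_derive j phi x) <= 0) /\
  (forall i j k phi, transition i -> incident G i j -> incident G i k ->
     j <> k -> continuous_net phi -> jk_differentiable i j k phi ->
     net_local_max (u \- phi) (vertex G i) ->
     H j (param j (vertex G i)) (edge_derive j phi (vertex G i)) <= 0).

Definition supersolution_cond H u : Prop :=
  (forall j x phi, open_edge G j x -> continuous_net phi ->
     edge_derivable j phi x -> net_local_min (u \- phi) x ->
     0 <= H j (param j x) (edge_derive j phi x)) /\
  (forall i j, transition i -> incident G i j ->
     exists k, [/\ incident G i k, k <> j &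
       forall phi, continuous_net phi -> jk_differentiable i j k phi ->
         net_local_min (u \- phi) (vertex G i) ->
         0 <= H j (param j (vertex G i)) (edge_derive j phi (vertex G i))]).

Definition viscosity_solution H u : Prop :=
  [/\ continuous_net u, subsolution_cond H u & supersolution_cond H u].

End network_theory.

(* Main.v *)
Require Import Defs.
From mathcomp Require Import all_boot all_order all_algebra.
From mathcomp Require Import all_classical all_reals all_analysis.
From mathcomp Require Import ring lra.
Import Order.TTheory GRing.Theory Num.Theory.
Import numFieldNormedType.Exports.

(** Both halves of the viscosity property survive uniform limits by the usual
    perturbed test function argument, carried out in one real variable along a
    chart of the network.

    A chart is an injective continuous path [g] from an interval [[-r, r]] into
    the network: a piece of an edge around an interior point, or, at a vertex,
    the concatenation of the two arms [j] and [k] whose derivatives are coupled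
    by the transition condition. In the chart of a vertex, being
    (j, k)-differentiable just means that the one-sided slopes of [phi \o g] at
    [0] agree, so interior points and vertices become the same problem.

    Suppose [u - phi] has a local maximum at [g 0] and [phi \o g] has slope [p]
    at [0]. Then [u (g s) <= u (g 0) + p * s + o(s)], and subtracting a parabola
    [psi s = p * s + c * s ^+ 2], steep enough to beat the error term at the ends
    of a short interval but whose slope there is still close to [p], leaves the
    ends strictly below the centre. The same is true for every [w] uniformly close
    to [u], so [w \o g - psi] has a maximum at a point inside the interval, where
    the condition on [w] gives an inequality at a nearby point and a nearby slope.
    Letting the interval shrink, continuity of the Hamiltonian gives the inequality
    for [u] ([chart_sub_closed]). At a vertex this continuity across [s = 0] is
    exactly the compatibility and evenness of the Hamiltonian at vertices.

    What remains is to see [psi] as a test function on the whole network. The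
    inverse of the chart is continuous on its compact image, so [psi] extends to
    a continuous function [Psi] on the ambient space; replacing it by
    [max (Psi, w - w x + Psi x)] does not change it on the image of the chart,
    and turns the maximum [x] along the chart into a maximum over the network
    ([chart_test_function]). The other arms of a vertex thus need no estimate.

    Supersolutions reduce to subsolutions through [u |-> - u] and
    [F |-> - F(., - p)]. The second arm [k] in their vertex condition depends on
    [n], but it ranges over a finite set, so one [k] serves infinitely many [n],
    which is all that the approximation argument uses. *)

Set Implicit Arguments.
Unset Strict Implicit.
Unset Printing Implicit Defensive.

Local Open Scope classical_set_scope.
Local Open Scope ring_scope.
Local Open Scope card_scope.

(** * Continuity, cardinality and convergence *)

Lemma comp_within_continuous (T U V : topologicalType) (A : set T) (B : set U)
    (f : T -> U) (g : U -> V) :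
  {within A, continuous f} -> {within B, continuous g} -> f @` A `<=` B ->
  {within A, continuous (g \o f)}.
Proof.
move=> /subspace_continuousP cf /subspace_continuousP cg fAB.
apply/subspace_continuousP => x Ax.
have Bfx : B (f x) by apply: fAB; exists x.
apply: cvg_comp (cg _ Bfx) => W /= WB.
have := cf x Ax _ WB; rewrite /nbhs /= /within /=; apply: filterS => y Wy Ay.
by apply: Wy => //; apply: fAB; exists y.
Qed.

(** Closed subsets of [A] are compact, so their images are compact, hence
    closed: [f] is a closed map onto its image. *)
Lemma within_continuous_pinv (T U : topologicalType) (dflt : U -> T)
    (A : set T) (f : T -> U) :
  hausdorff_space U -> compact A -> {within A, continuous f} ->
  {in A &, injective f} -> {within f @` A, continuous ('pinv_dflt A f)}.
Proof.
move=> hU cA cf fI; apply/continuous_closedP => C cC.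
apply/closed_subspaceP; exists (f @` (A `&` C)).
  apply: compact_closed => //; apply: continuous_compact.
    by apply: continuous_subspaceW cf; exact: subIsetl.
  exact: compact_closedI.
apply/seteqP; split => y /=.
  move=> [[x [Ax Cx] <-] _]; split; last by exists x.
  by rewrite /from_subspace (pinvKV dflt fI) ?inE.
move=> [] /[swap] -[x Ax <-]; rewrite /from_subspace (pinvKV dflt fI) ?inE// => Cx.
by split; exists x.
Qed.

Lemma derivable_in_continuous (R : realType) (W : normedModType R) (A : set R)
    (f : R -> W) t :
  derivable_in A f t -> f @ within A (nbhs t) --> f t.
Proof.
move=> /cvg_ex[d cd].
have c0 : (s - t) @[s --> within A t^'] --> (0 : R).
  have : (s - t) @[s --> t] --> t - t.
    by apply: cvgB; [exact: cvg_id|exact: cvg_cst].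
  rewrite subrr; apply: cvg_trans; apply: cvg_fmap2.
  by apply: cvg_trans (cvg_within _) (cvg_within _).
have cf : (s - t) *: diff_quotient f t s + f t @[s --> within A t^'] --> f t.
  have := cvgD (cvgZ c0 cd) (cvg_cst (f t)); rewrite scale0r add0r; exact.
move=> V Vft; change (\forall s \near within A (nbhs t), V (f s)).
have : \forall s \near within A t^',
  V ((s - t) *: diff_quotient f t s + f t) by exact: cf V Vft.
rewrite !near_withinE => h.
apply: filterS h => s h As.
have [->|st] := eqVneq s t; first exact: nbhs_singleton Vft.
by have := h st As; rewrite /diff_quotient scalerA divff ?subr_eq0// scale1r subrK.
Qed.

Lemma card_le_natP (T : Type) (A : set T) n : A #<= `I_n ->
  exists f : T -> nat, {in A &, injective f} /\ forall x, A x -> (f x < n)%N.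
Proof.
move=> /pcard_leP/unsquash f; exists f; split; first exact: inj.
by move=> x Ax; have := @funS _ _ _ _ f x Ax.
Qed.

Lemma near_affine_gt0 (R : realType) (a t s : R) : 0 < s ->
  \forall x \near t, 0 < s + a * (x - t).
Proof.
move=> s0; have c : s + a * (x - t) @[x --> t] --> s.
  rewrite -[X in _ --> X]addr0 -[X in _ + X](mulr0 a) -[X in a * X](subrr t).
  apply: cvgD; first exact: cvg_cst.
  by apply: cvgM; [exact: cvg_cst|apply: cvgB; [exact: cvg_id|exact: cvg_cst]].
exact: c _ (lt_nbhsr s0).
Qed.

Lemma uniform_near (T : choiceType) (R : realType) (A : set T)
    (f : nat -> T -> R) (f0 : T -> R) :
  {uniform A, f @ \oo --> f0} -> forall eta : R, 0 < eta ->
  \forall n \near \oo, forall x, A x -> `|f n x - f0 x| <= eta.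
Proof.
move=> cf eta eta0.
have /cf : nbhs (f0 : {uniform` A -> R})
    [set h : T -> R | forall x, A x -> `|h x - f0 x| <= eta].
  apply/uniform_nbhs; exists [set xy | ball xy.1 (PosNum eta0)%:num xy.2].
  split; first exact: entourage_ball.
  by move=> h hA x /hA; rewrite /ball/= distrC => /ltW.
exact.
Qed.

(** Pigeonhole along a sequence: otherwise every [k] is eventually excluded, hence,
    [J] being finite, all of them are excluded at once. *)
Lemma frequently_finite (J : finType) (Q : nat -> J -> Prop) :
  (forall n, exists k, Q n k) ->
  exists k, forall P : nat -> Prop, (\forall n \near \oo, P n) ->
    exists n, P n /\ Q n k.
Proof.
move=> hQ; apply: contrapT => /forallNP h.
have : \forall n \near \oo, forall k, ~ Q n k.
  apply: filter_forall => k; have /existsNP[P /not_implyP[nP /forallNP hP]] := h k.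
  by apply: filterS nP => n Pn Qn; apply: (hP n).
by move=> /filter_ex[n hn]; have [k /hn] := hQ n.
Qed.

(** * One-sided slopes *)

Section slope.
Context {R : realType}.
Implicit Types (A B : set R) (f g : R -> R) (t s d e a : R).

(** A first-order expansion rather than a limit of quotients: there is no division,
    [t] itself may lie in [A], and expansions along [A] and along [B] add up to one
    along their union, which is how the two arms of a vertex are glued. *)
Definition slope A f t d := forall e, 0 < e ->
  \forall s \near t, A s -> `|f s - f t - d * (s - t)| <= e * `|s - t|.

Lemma slopeP A f t d : ProperFilter (within A t^') ->
  slope A f t d <-> derivable_in A f t /\ derive_in A f t = d.
Proof.
move=> PF.
have E : slope A f t d <-> diff_quotient f t s @[s --> within A t^'] --> d.
  split.
    move=> S; apply/cvgrPdist_le => e e0.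
    have := S e e0; rewrite !near_withinE; apply: filterS => s h st As.
    have st0 : s - t != 0 by rewrite subr_eq0.
    change (`|d - diff_quotient f t s| <= e).
    have -> : d - diff_quotient f t s = - ((s - t)^-1 * (f s - f t - d * (s - t))).
      by rewrite /diff_quotient /GRing.scale /=; field.
    by rewrite normrN normrM normfV mulrC ler_pdivrMr ?normr_gt0//; exact: h.
  move=> /cvgrPdist_le S e e0; have := S e e0; rewrite !near_withinE.
  apply: filterS => s h As; have [->|st] := eqVneq s t.
    by rewrite !subrr mulr0 subr0 normr0 mulr0.
  have st0 : s - t != 0 by rewrite subr_eq0.
  have -> : f s - f t - d * (s - t) = - ((d - diff_quotient f t s) * (s - t)).
    by rewrite /diff_quotient /GRing.scale /=; field.
  by rewrite normrN normrM ler_wpM2r//; exact: h.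
rewrite E; split => [h|[c <-]]; last exact: c.
by split; [apply/cvg_ex; exists d|apply: cvg_lim h => //; exact: norm_hausdorff].
Qed.

Lemma slopeU A B f t d :
  slope A f t d -> slope B f t d -> slope (A `|` B) f t d.
Proof.
by move=> SA SB e e0; have := SB e e0; have := SA e e0;
   apply: filterS2 => s hA hB [/hA|/hB].
Qed.

(** Change of variable [x |-> t + a * (x - s)] with [a] one of [1] and [-1]: the
    slope is multiplied by [a]. The inverse of such a map has the same form, so this
    one statement serves to pass from an edge to a chart and back. *)
Lemma slope_affine A B f g t s a d : a * a = 1 ->
  (\forall x \near s, B x -> A (t + a * (x - s)) /\ g x = f (t + a * (x - s))) ->
  B s ->
  slope A f t d -> slope B g s (a * d).
Proof.
move=> a2 h Bs S e e0.
have a1 : `|a| = 1.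
  by apply/eqP; rewrite -(@eqrXn2 _ 2)// expr2 -normrM a2 normr1 expr1n.
have ct : t + a * (x - s) @[x --> s] --> t.
  rewrite -[X in _ --> X]addr0 -[X in _ + X](mulr0 a) -[X in a * X](subrr s).
  apply: cvgD; first exact: cvg_cst.
  by apply: cvgM; [exact: cvg_cst|apply: cvgB; [exact: cvg_id|exact: cvg_cst]].
have := ct _ (S e e0); rewrite /= /nbhs /=.
have [_] := nbhs_singleton h Bs; rewrite subrr mulr0 addr0 => gs.
move: h; apply: filterS2 => x h1 h2 Bx.
have [Ax ->] := h1 Bx; rewrite gs.
have := h2 Ax; rewrite (addrAC t) subrr add0r.
have -> : d * (a * (x - s)) = a * d * (x - s) by ring.
by rewrite normrM a1 mul1r.
Qed.

Lemma slope_quadratic (p c s : R) :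
  slope setT (fun x => p * x + c * x ^+ 2) s (p + c * s *+ 2).
Proof.
move=> e e0.
have h : \forall x \near s, `|c * (x - s)| <= e.
  have : c * (x - s) @[x --> s] --> 0.
    rewrite -[X in _ --> X](mulr0 c) -[X in c * X](subrr s).
    by apply: cvgM; [exact: cvg_cst|apply: cvgB; [exact: cvg_id|exact: cvg_cst]].
  move=> /cvgrPdist_le /(_ e e0); apply: filterS => x.
  by rewrite sub0r normrN.
apply: filterS h => x h _.
have -> : p * x + c * x ^+ 2 - (p * s + c * s ^+ 2) - (p + c * s *+ 2) * (x - s)
  = (c * (x - s)) * (x - s) by ring.
by rewrite normrM ler_wpM2r.
Qed.

Lemma slopeN A f t d : slope A f t d -> slope A (fun x => - f x) t (- d).
Proof.
move=> S e /S; apply: filterS => s h /h; rewrite -normrN.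
by congr (`| _ | <= _); ring.
Qed.

Lemma slope_near A f g t d : (\forall x \near t, A x -> f x = g x) -> A t ->
  slope A f t d -> slope A g t d.
Proof.
move=> h At S e /S; have E := nbhs_singleton h At; move: h.
by apply: filterS2 => s h + As; rewrite h// E; exact.
Qed.

Lemma dnbhs_itv_proper (l t : R) : 0 < l -> t \in `[0, l] ->
  ProperFilter (within `[0, l] t^').
Proof.
rewrite in_itv /= => l0 /andP[t0 tl]; apply: Build_ProperFilter.
move=> /nbhs_ballP[e /= e0 h].
have m0 : 0 < Num.min e l / 3 by rewrite divr_gt0// lt_min e0 l0.
have me : Num.min e l / 3 < e.
  by rewrite ltr_pdivrMr// gt_min; apply/orP; left; lra.
have ml : Num.min e l / 3 <= l / 3 by rewrite ler_pM2r// ge_min lexx orbT.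
have [tl2|tl2] := leP t (l / 2).
  apply: (h (t + Num.min e l / 3)); rewrite /= ?in_itv/=.
  - by rewrite /ball/= opprD addrA subrr add0r normrN gtr0_norm.
  - by rewrite -subr_eq0 addrAC subrr add0r gt_eqF.
  - by apply/andP; split; lra.
apply: (h (t - Num.min e l / 3)); rewrite /= ?in_itv/=.
- by rewrite /ball/= opprB addrCA subrr addr0 gtr0_norm.
- by rewrite -subr_eq0 addrAC subrr add0r oppr_eq0 gt_eqF.
- by apply/andP; split; lra.
Qed.

End slope.

(** * Test functions along a chart *)

Section charts.
Context {R : realType} {N : nat} {I J : finType} (G : network R N I J).
Local Notation point := 'rV[R]_N.
Implicit Types (g : R -> point) (w u phi : point -> R) (K : R -> R -> R).

(** The maximum with [w - (w x - psi s0)], where [x = g s0], is inactive along the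
    chart because [s0] is a maximum of [w \o g - psi] there, and it makes [x] a
    maximum of [w - phi] over the whole network. *)
Lemma chart_test_function (A : set R) g w (psi : R -> R) s0 :
  compact A -> {within A, continuous g} -> {in A &, injective g} ->
  g @` A `<=` net_interior G -> continuous_net G w ->
  continuous psi -> A s0 ->
  (forall s, A s -> w (g s) - psi s <= w (g s0) - psi s0) ->
  exists phi, [/\ continuous_net G phi, {in A, phi \o g =1 psi} &
    net_local_max G (w \- phi) (g s0)].
Proof.
move=> cA cg gI gA cw cpsi As0 mx.
pose ginv := 'pinv_(fun=> 0) A g.
have gK s : A s -> ginv (g s) = s by move=> As; rewrite /ginv pinvKV ?inE.
have hV : hausdorff_space point by exact: norm_hausdorff.
(* Extend [psi \o ginv] from the compact image of the chart. *)
have cgA : compact (g @` A) by exact: continuous_compact.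
have cf : {within g @` A, continuous (psi \o ginv)}.
  have c1 := within_continuous_pinv (dflt := fun=> 0) hV cA cg gI.
  have c2 : {within [set: R], continuous psi} by exact: continuous_subspaceT.
  exact: (comp_within_continuous c1 c2).
have /compact_bounded[M [_ bdM]] := continuous_compact cf cgA.
have bd (x : point) : (g @` A) x -> `|(psi \o ginv) x| <= Num.max M 0 + 1.
  move=> Ax; apply: bdM; last by exists x.
  by rewrite (le_lt_trans (y := Num.max M 0)) ?le_max ?lexx// ltrDl.
have M0 : 0 < Num.max M 0 + 1 by rewrite ltr_wpDl// le_max lexx orbT.
have [Psi [EPsi cPsi _]] := continuous_bounded_extension pseudometric_normal
  (compact_closed hV cgA) M0 cf bd.
have EP s : A s -> Psi (g s) = psi s.
  by move=> As; rewrite -EPsi ?inE/= ?gK//; exists s.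
pose w' y := w y - (w (g s0) - psi s0).
have Ephi s : A s -> Num.max (Psi (g s)) (w' (g s)) = psi s.
  move=> As; rewrite EP//; apply/max_idPl; rewrite /w'.
  by have := mx _ As; lra.
exists (fun y => Num.max (Psi y) (w' y)); split.
- move=> x; apply: (@continuous_max R (subspace (net_interior G)) Psi w' x).
    exact: continuous_subspaceT.
  by apply: cvgB; [exact: cw|exact: cvg_cst].
- by move=> s /set_mem /Ephi.
- apply: filterE => y; rewrite /= Ephi//.
  have : w' y <= Num.max (Psi y) (w' y) by rewrite le_max lexx orbT.
  by rewrite /w'; lra.
Qed.

(** The subsolution condition read at parameter [s] of a path: [q] is the slope of
    the test function along the path, not along an edge. *)
Definition chart_sub g K w s := forall phi q,
  continuous_net G phi -> slope setT (phi \o g) s q ->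
  net_local_max G (w \- phi) (g s) -> K s q <= 0.

Definition chart (r : R) g :=
  [/\ {within `[- r, r], continuous g}, {in `[- r, r] &, injective g} &
      g @` `[- r, r] `<=` net_interior G].

(** The analytic core. [u] is approximated by pairs of a function and a
    Hamiltonian satisfying the condition near [0]; the pair may depend on the
    precision [eta], so that a subsequence is as good as a full sequence. *)
Lemma chart_sub_closed g (r0 : R) u K : 0 < r0 -> chart r0 g ->
  (forall p (eps : R), 0 < eps -> \forall z \near (0 : R, p : R), K 0 p <= K z.1 z.2 + eps) ->
  (forall eta : R, 0 < eta -> exists w L, [/\ continuous_net G w,
     forall y, net_interior G y -> `|w y - u y| <= eta,
     forall s q, `|s| < r0 -> `|L s q - K s q| <= eta &
     forall s, `|s| < r0 -> chart_sub g L w s]) ->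
  chart_sub g K u 0.
Proof.
move=> r00 [cg gI gG] cK apx phi p cphi sphi mx.
have gG' s : `|s| <= r0 -> net_interior G (g s).
  by rewrite ler_norml => sr; apply: gG; exists s; rewrite //= in_itv.
apply/ler_addgt0Pr => /= eps eps0; rewrite add0r.
have e30 : 0 < eps / 2 by rewrite divr_gt0.
have /nbhs_ballP[d /= d0 hd] := cK p _ e30.
(* Along the chart [u] lies below its tangent line up to an error small
   compared with the slope tolerance [d]. *)
have jet : \forall s \near (0 : R), `|s| < r0 ->
    u (g s) - u (g 0) <= p * s + d / 8 * `|s|.
  have d80 : 0 < d / 8 by rewrite divr_gt0.
  have h1 := sphi _ d80.
  have cg0 : g s @[s --> (0 : R)] --> g 0.
    move/subspace_continuousP : cg => /(_ 0); rewrite within_interior.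
      by apply; rewrite /= in_itv/= oppr_le0 ltW.
    rewrite interior_itv/= in_itv/= oppr_lt0 r00//.
  have h2 : \forall s \near (0 : R), net_interior G (g s) ->
      (u \- phi) (g s) <= (u \- phi) (g 0) by exact: (cg0 _ mx).
  move: h1 h2; apply: filterS2 => s /(_ Logic.I)/= h1 h2 sr.
  have {}h2 := h2 (gG' _ (ltW sr)); rewrite /= in h2.
  move: h1; rewrite subr0 ler_norml => /andP[_ h1]; lra.
have /nbhs_ballP[r1 /= r10 hr1] := jet.
pose r : R := Num.min (Num.min r0 r1) d / 2.
have r_gt0 : 0 < r by rewrite divr_gt0// !lt_min r00 r10 d0.
have [rr0 rr1 rd] : [/\ r < r0, r < r1 & r < d].
  have h : r < Num.min (Num.min r0 r1) d.
    by rewrite /r ltr_pdivrMr// ltr_pMr ?ltr1n// !lt_min r00 r10 d0.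
  by move: h; rewrite !lt_min => /andP[/andP[]].
(* At [|s| = r] the parabola is [d * r / 4] above the tangent line, which beats
   the error [d * r / 8] of the jet, while its slope differs from [p] by at most
   [2 * c * r = d / 2]. The tolerance [eta] is used twice, at [s0] and at [0]. *)
pose c := d / (4 * r).
have cr : c * r = d / 4 by rewrite /c; field; rewrite gt_eqF.
have cpos : 0 < c by rewrite divr_gt0// mulr_gt0.
pose psi (s : R) := p * s + c * s ^+ 2.
pose eta := Num.min (eps / 2) (d * r / 32).
have eta0 : 0 < eta by rewrite lt_min e30 divr_gt0// mulr_gt0.
have [w [L [cw wu LK tests]]] := apx _ eta0.
have rsub : `[- r, r] `<=` `[- r0, r0].
  by apply: subset_itv; rewrite bnd_simp ?lerN2 ltW.
have cgr : {within `[- r, r], continuous g} by exact: continuous_subspaceW cg.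
have gGr : g @` `[- r, r] `<=` net_interior G.
  by move=> _ [s sr <-]; apply: gG; exists s => //; exact: rsub.
have cpsi : continuous psi.
  move=> s; apply: cvgD; first by apply: cvgM; [exact: cvg_cst|exact: cvg_id].
  by apply: cvgM; [exact: cvg_cst|exact: exprn_continuous].
have [s0 s0r s0mx] : exists2 s0 : R, s0 \in `[- r, r] &
    forall s : R, s \in `[- r, r] -> w (g s) - psi s <= w (g s0) - psi s0.
  apply: EVT_max; first by lra.
  move=> s; apply: cvgB; last by apply: continuous_subspaceT.
  exact: (comp_within_continuous cgr cw gGr).
(* The maximum is not at an end of the interval. *)
have s0i : `|s0| < r.
  have := s0mx 0; rewrite in_itv/= oppr_le0 ltW// => /(_ isT).
  rewrite /psi mulr0 expr0n/= mulr0 addr0 subr0.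
  move: s0r; rewrite in_itv/= -ler_norml le_eqVlt => /orP[/eqP s0E|//].
  have s2 : c * s0 ^+ 2 = d * r / 4.
    by rewrite -(real_normK (num_real s0)) s0E expr2 mulrA cr mulrAC.
  have ball1 : ball (0 : R) r1 s0 by rewrite /ball /= sub0r normrN s0E.
  have /(_ _)/= := hr1 _ ball1; rewrite s0E => /(_ rr0).
  have := wu (g s0) (gG' _ _); rewrite s0E (ltW rr0) => /(_ isT).
  have := wu (g 0) (gG' _ _); rewrite normr0 (ltW r00) => /(_ isT).
  have : eta <= d * r / 32 by rewrite ge_min lexx orbT.
  rewrite s2 !ler_norml => ? /andP[? ?] /andP[? ?] ? ?.
  have : 0 < d * r by rewrite mulr_gt0.
  lra.
have [phi1 [cphi1 Ephi mx1]] : exists phi, [/\ continuous_net G phi,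
    {in [set` `[- r, r]], phi \o g =1 psi} & net_local_max G (w \- phi) (g s0)].
  apply: chart_test_function => //.
  - exact: segment_compact.
  - by move=> x y /set_mem/rsub xr /set_mem/rsub yr; apply: gI.
have s0r0 : `|s0| < r0 by exact: lt_trans rr0.
have sl : slope setT (phi1 \o g) s0 (p + c * s0 *+ 2).
  apply: (@slope_near _ _ psi) => //; last exact: slope_quadratic.
  have s0oo : s0 \in `]- r, r[ by rewrite in_itv/= -ltr_norml.
  apply: filterS (near_in_itvoo s0oo) => s sr _; apply/esym/Ephi.
  by rewrite inE; exact: subset_itv_oo_cc.
have := tests _ s0r0 _ _ cphi1 sl mx1.
have bz : ball (0 : R, p) d (s0, p + c * s0 *+ 2).
  split; rewrite /= /ball /=.
    by rewrite sub0r normrN (lt_trans s0i).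
  rewrite opprD addrA subrr sub0r normrN -mulrnAr normrM gtr0_norm//.
  have : c * `|s0| < c * r by rewrite ltr_pM2l.
  rewrite cr normrMn mulrnAr; lra.
have := hd _ bz; rewrite /=.
have := LK _ (p + c * s0 *+ 2) s0r0; rewrite ler_norml => /andP[? ?] ? ?.
have : eta <= eps / 2 by rewrite ge_min lexx.
lra.
Qed.

End charts.

(** * Geometry of the network *)

Section geometry.
Context {R : realType} {N : nat} {I J : finType} (G : network R N I J).
Local Notation point := 'rV[R]_N.

Lemma curve_continuous j : {within `[0, len G j], continuous (curve G j)}.
Proof.
apply/subspace_continuousP => t tl; apply: derivable_in_continuous.
exact: net_curve_derivable.
Qed.

Lemma param_curve j t : t \in `[0, len G j] -> param G j (curve G j t) = t.
Proof.
move=> tl; rewrite /param pinvKV ?inE//.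
by move=> x y; rewrite !inE; exact: net_curve_inj.
Qed.

Lemma curve_param j x : closed_edge G j x ->
  param G j x \in `[0, len G j] /\ curve G j (param G j x) = x.
Proof. by move=> [t tl <-]; rewrite param_curve. Qed.

(** Both ends are vertices and a closed edge meets only two of them. *)
Lemma curve_vertex j t i : t \in `[0, len G j] -> curve G j t = vertex G i ->
  t = 0 \/ t = len G j.
Proof.
move=> tl ti; have l0 := net_len_gt0 G j.
have i0 : 0 \in `[0, len G j] by rewrite in_itv/= lexx ltW.
have il : len G j \in `[0, len G j] by rewrite in_itv/= lexx ltW.
have [v0 vl] := net_curve_ends G j.
have := net_edge_vertices G j; rewrite card_eq_le => /andP[+ _].
move=> /card_le_natP[f [fI f2]].
have mem s : s \in `[0, len G j] -> range (vertex G) (curve G j s) ->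
    (closed_edge G j `&` range (vertex G)) (curve G j s).
  by move=> sl vs; split => //; exists s.
have m0 := mem _ i0 v0; have ml := mem _ il vl.
have mt : (closed_edge G j `&` range (vertex G)) (curve G j t).
  by apply: mem => //; rewrite ti; exists i.
have eqf s s' : s \in `[0, len G j] -> s' \in `[0, len G j] ->
    (closed_edge G j `&` range (vertex G)) (curve G j s) ->
    (closed_edge G j `&` range (vertex G)) (curve G j s') ->
    f (curve G j s) = f (curve G j s') -> s = s'.
  move=> sl s'l ms ms' e; apply: (net_curve_inj (n := G) (j := j)) => //.
  by apply: fI => //; rewrite inE.
have := f2 _ m0; have := f2 _ ml; have := f2 _ mt.
have := eqf _ _ tl i0 mt m0; have := eqf _ _ tl il mt ml.
have := eqf _ _ il i0 ml m0.
move: (f (curve G j t)) (f (curve G j 0)) (f (curve G j (len G j))).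
move=> [|[|//]] [|[|//]] [|[|//]] e1 e2 e3 _ _ _; try by [left; exact: e3|right; exact: e2].
all: by have := e1 erefl; move: l0 => /[swap] ->; rewrite ltxx.
Qed.

Lemma open_edge_interior j t : t \in `]0, len G j[ ->
  net_interior G (curve G j t).
Proof.
move=> tl; have tl' := subset_itv_oo_cc tl; split.
  by exists j => //; exists t.
move=> [i _ /esym it]; have [t0|tE] := curve_vertex tl' it.
  by move: tl; rewrite t0 in_itv/= ltxx.
by move: tl; rewrite tE in_itv/= ltxx andbF.
Qed.

Lemma transition_interior i j : transition G i -> incident G i j ->
  net_interior G (vertex G i).
Proof.
move=> ti ij; split; first by exists j.
by move=> [k bk /(net_vertex_inj (n := G)) ki]; apply: ti; rewrite -ki.
Qed.

Lemma edges_meet_once j k x y : j <> k -> closed_edge G j x ->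
  closed_edge G k x -> closed_edge G j y -> closed_edge G k y -> x = y.
Proof.
move=> jk jx kx jy ky; have [_ /card_le_natP[f [fI f1]]] := net_edges_meet G jk.
have mx : (closed_edge G j `&` closed_edge G k) x by [].
have my : (closed_edge G j `&` closed_edge G k) y by [].
apply: fI; rewrite ?inE//.
by have := f1 _ mx; have := f1 _ my; rewrite !ltnS !leqn0 => /eqP -> /eqP ->.
Qed.

(** The arm of edge [j] issuing from vertex [i] is
    [s |-> curve G j (orig i j + incidence G i j * s)], for [s] from [0] to the
    length of the edge: the incidence is its direction in the parameter of the
    edge. *)
Definition orig i j : R := param G j (vertex G i).

(** One description for both orientations, so that no later argument has to
    distinguish whether the edge starts or ends at the vertex. *)
Lemma armP i j : incident G i j ->
  [/\ incidence G i j * incidence G i j = 1,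
      orig i j \in `[0, len G j], curve G j (orig i j) = vertex G i,
      forall s, 0 <= s <= len G j -> orig i j + incidence G i j * s \in `[0, len G j] &
      [/\ forall s, 0 < s < len G j -> orig i j + incidence G i j * s \in `]0, len G j[ &
      forall x, x \in `[0, len G j] -> 0 <= incidence G i j * (x - orig i j)]].
Proof.
move=> ij; have [ol oc] := curve_param ij; rewrite -/(orig i j) in ol oc.
have l0 := net_len_gt0 G j.
have i0 : 0 \in `[0, len G j] by rewrite in_itv/= lexx ltW.
have il : len G j \in `[0, len G j] by rewrite in_itv/= lexx ltW.
rewrite /incidence; case: eqP => [c0|n0].
  have -> : orig i j = 0 by rewrite /orig -c0 param_curve.
  rewrite mul1r c0; split => // [s|].
  - by rewrite add0r mul1r in_itv.
  - split=> s; first by rewrite add0r mul1r in_itv.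
    by rewrite in_itv/= mul1r subr0 => /andP[].
have oE : orig i j = len G j.
  case: (curve_vertex ol oc) => // o0.
  by case: n0; rewrite -oc o0.
rewrite -oc oE eqxx mulN1r opprK; split => // [s /andP[? ?]|].
  by rewrite in_itv/=; apply/andP; split; lra.
split=> s; first by move=> /andP[? ?]; rewrite in_itv/=; apply/andP; split; lra.
by rewrite in_itv/= => /andP[? ?]; lra.
Qed.

(** The path running along arm [k] towards vertex [i] for negative parameters, and
    away from it along arm [j] for positive ones. *)
Definition junction_chart i j k (s : R) : point :=
  if 0 <= s then curve G j (orig i j + incidence G i j * s)
  else curve G k (orig i k + - incidence G i k * s).

Lemma junction_chart0 i j k : incident G i j -> junction_chart i j k 0 = vertex G i.
Proof. by move=> /armP[_ _ oj _ _]; rewrite /junction_chart lexx mulr0 addr0. Qed.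

Lemma junction_chart_npos i j k s : incident G i j -> incident G i k -> s <= 0 ->
  junction_chart i j k s = curve G k (orig i k + - incidence G i k * s).
Proof.
move=> ij ik; rewrite le_eqVlt /junction_chart => /orP[/eqP ->|s0].
  by rewrite -/(junction_chart i j k 0) junction_chart0// mulr0 addr0;
     have [_ _ ->] := armP ik.
by rewrite leNgt s0.
Qed.

(** Injectivity across the two arms is where it matters that two distinct edges
    share at most one point, here the vertex [i] itself. *)
Lemma junction_chartP i j k : transition G i -> incident G i j ->
  incident G i k -> j <> k ->
  exists r, [/\ 0 < r, chart G r (junction_chart i j k),
    forall s, 0 <= s <= r -> orig i j + incidence G i j * s \in `[0, len G j],
    forall s, - r <= s <= 0 -> orig i k + - incidence G i k * s \in `[0, len G k] &
    (forall s, 0 < s <= r -> orig i j + incidence G i j * s \in `]0, len G j[) /\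
    (forall s, - r <= s < 0 ->
       orig i k + - incidence G i k * s \in `]0, len G k[)].
Proof.
move=> ti ij ik jk.
have [aj2 ojl oj ajl [ajoo aj0]] := armP ij.
have [ak2 okl ok akl [akoo ak0]] := armP ik.
have g0 := junction_chart0 k ij.
have gkE s := @junction_chart_npos _ _ _ s ij ik.
set g := junction_chart i j k in g0 gkE *.
set aj := incidence G i j in aj2 ajl ajoo aj0 *.
set ak := incidence G i k in ak2 akl akoo ak0 gkE *.
set tj := orig i j in ojl oj ajl ajoo aj0 *.
set tk := orig i k in okl ok akl akoo ak0 gkE *.
have lj0 := net_len_gt0 G j; have lk0 := net_len_gt0 G k.
pose r : R := Num.min (len G j) (len G k) / 2.
have r0 : 0 < r by rewrite divr_gt0// lt_min lj0.
have [rj rk] : r < len G j /\ r < len G k.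
  have h : r < Num.min (len G j) (len G k).
    by rewrite /r ltr_pdivrMr// ltr_pMr ?ltr1n// lt_min lj0.
  by move: h; rewrite lt_min => /andP[].
pose gj (s : R) := curve G j (tj + aj * s).
pose gk (s : R) := curve G k (tk + - ak * s).
have gk0 : gk 0 = vertex G i by rewrite /gk mulr0 addr0.
have akNN s : - ak * s = ak * - s by rewrite mulNr mulrN.
have jl (s : R) : 0 <= s <= r -> tj + aj * s \in `[0, len G j].
  by move=> /andP[s0 sr]; apply: ajl; rewrite s0 (le_trans sr)// ltW.
have kl (s : R) : - r <= s <= 0 -> tk + - ak * s \in `[0, len G k].
  move=> /andP[s0 sr]; rewrite akNN; apply: akl; rewrite oppr_ge0 sr/=.
  by rewrite (@le_trans _ _ r) ?(ltW rk)// lerNl.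
have joo (s : R) : 0 < s <= r -> tj + aj * s \in `]0, len G j[.
  by move=> /andP[s0 sr]; apply: ajoo; rewrite s0 (le_lt_trans sr).
have koo (s : R) : - r <= s < 0 -> tk + - ak * s \in `]0, len G k[.
  move=> /andP[s0 sr]; rewrite akNN; apply: akoo; rewrite oppr_gt0 sr/=.
  by rewrite (@le_lt_trans _ _ r)// lerNl.
have itvU : [set` `[- r, r]] = [set` `[- r, 0]] `|` [set` `[0, r]].
  apply/seteqP; split => s /=; rewrite !in_itv/=.
    by move=> /andP[s1 s2]; have [s0|/ltW s0] := leP 0 s; [right|left]; apply/andP.
  by move=> [] /andP[s1 s2]; apply/andP; split => //; lra.
have affc t a : continuous (fun s : R => t + a * s).
  move=> s; apply: cvgD; first exact: cvg_cst.
  by apply: cvgM; [exact: cvg_cst|exact: cvg_id].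
have aj_inj x y : tj + aj * x = tj + aj * y -> x = y.
  move=> /addrI e; have := congr1 ( *%R aj) e.
  by rewrite !mulrA aj2 !mul1r.
have ak_inj x y : tk + - ak * x = tk + - ak * y -> x = y.
  move=> /addrI e; have := congr1 ( *%R (- ak)) e.
  by rewrite !mulrA mulrNN ak2 !mul1r.
(* The arms meet only at the vertex, which is at parameter [0]. *)
have cross x y : - r <= x < 0 -> 0 <= y <= r -> gk x <> gj y.
  move=> xr yr e.
  have x' : - r <= x <= 0 by case/andP: xr => -> /ltW ->.
  have e' : gk x = vertex G i.
    apply: (edges_meet_once jk _ _ ij ik).
    - by rewrite e; exists (tj + aj * y) => //; exact: jl.
    - by exists (tk + - ak * x) => //; exact: kl.
  move: e'; rewrite -gk0 => /(net_curve_inj (n := G) (j := k)).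
  rewrite mulr0 addr0 => /(_ (kl _ x') okl); rewrite -[RHS]addr0 => /addrI.
  rewrite -(mulr0 (- ak)) => h; have := ak_inj x 0; rewrite h => /(_ erefl) x0.
  by move: xr; rewrite x0 ltxx andbF.
exists r; split => //.
  split.
  - rewrite itvU; apply: withinU_continuous; [exact: itv_closed|exact: itv_closed| |].
      apply: (@subspace_eq_continuous _ _ _ gk).
        by move=> s; rewrite inE/= in_itv/= => /andP[_ s0]; exact/esym/gkE.
      apply: comp_within_continuous (@curve_continuous k) _.
        exact: continuous_subspaceT.
      by move=> _ [s sr <-]; apply: kl; move: sr; rewrite /= in_itv.
    apply: (@subspace_eq_continuous _ _ _ gj).
      by move=> s; rewrite inE/= in_itv/= => /andP[s0 _]; rewrite /from_subspace /g /junction_chart s0.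
    apply: comp_within_continuous (@curve_continuous j) _.
      exact: continuous_subspaceT.
    by move=> _ [s sr <-]; apply: jl; move: sr; rewrite /= in_itv.
  - move=> x y; rewrite !in_itv/= /g /junction_chart => /andP[x1 x2] /andP[y1 y2].
    have [x0|x0] := leP 0 x; have [y0|y0] := leP 0 y.
    + move=> /(net_curve_inj (n := G) (j := j)) h; apply/aj_inj/h; apply: jl.
        by rewrite x0.
      by rewrite y0.
    + by move=> /esym/cross; case; rewrite ?y1 ?x0.
    + by move=> /cross; case; rewrite ?x1 ?y0.
    + move=> /(net_curve_inj (n := G) (j := k)) h; apply/ak_inj/h; apply: kl.
        by rewrite x1 ltW.
      by rewrite y1 ltW.
  - move=> _ [s + <-]; rewrite /= in_itv/= => /andP[s1 s2].
    have [s0|s0|<-] := ltgtP 0 s; last by rewrite g0; exact: transition_interior ij.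
      by rewrite /g /junction_chart ltW//; apply: open_edge_interior; apply: joo; rewrite s0.
    by rewrite gkE ?ltW//; apply: open_edge_interior; apply: koo; rewrite s0 s1.
Qed.

End geometry.

(** * Stability of the subsolution conditions *)

Section stability.
Context {R : realType} {N : nat} {I J : finType} (G : network R N I J).
Local Notation point := 'rV[R]_N.
Implicit Types (u w phi : point -> R) (F L : J -> R -> R -> R).

Definition edge_sub F w : Prop := forall j x phi,
  open_edge G j x -> continuous_net G phi -> edge_derivable G j phi x ->
  net_local_max G (w \- phi) x ->
  F j (param G j x) (edge_derive G j phi x) <= 0.

Definition junction_sub F w i j k : Prop := forall phi,
  continuous_net G phi -> jk_differentiable G i j k phi ->
  net_local_max G (w \- phi) (vertex G i) ->
  F j (param G j (vertex G i)) (edge_derive G j phi (vertex G i)) <= 0.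

Lemma edge_slopeP j x phi d : closed_edge G j x ->
  slope `[0, len G j] (phi \o curve G j) (param G j x) d <->
  edge_derivable G j phi x /\ edge_derive G j phi x = d.
Proof.
move=> /curve_param[xl _]; apply: slopeP.
exact: dnbhs_itv_proper (net_len_gt0 G j) xl.
Qed.

Lemma edge_subP F w : edge_sub F w <->
  forall j t phi d, t \in `]0, len G j[ -> continuous_net G phi ->
    slope `[0, len G j] (phi \o curve G j) t d ->
    net_local_max G (w \- phi) (curve G j t) -> F j t d <= 0.
Proof.
split=> [h j t phi d tl cphi sl mx|h j _ phi [t tl <-] cphi dphi mx].
  have tl' := subset_itv_oo_cc tl.
  have cx : closed_edge G j (curve G j t) by exists t.
  move: (sl); rewrite -(param_curve tl') => /(edge_slopeP _ _ cx)[dphi <-].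
  by apply: h => //; exists t.
have tl' := subset_itv_oo_cc tl.
have cx : closed_edge G j (curve G j t) by exists t.
have := (edge_slopeP phi _ cx).2 (conj dphi erefl).
by rewrite param_curve// => sl; apply: h sl mx.
Qed.

(** The transition condition on the two edge derivatives says that they are
    [incidence G i j * q] and [- incidence G i k * q] for a common [q], the slope
    of the test function along the junction chart. *)
Lemma junction_subP F w i j k : incident G i j -> incident G i k ->
  junction_sub F w i j k <->
  forall phi q, continuous_net G phi ->
    slope `[0, len G j] (phi \o curve G j) (orig G i j) (incidence G i j * q) ->
    slope `[0, len G k] (phi \o curve G k) (orig G i k) (- incidence G i k * q) ->
    net_local_max G (w \- phi) (vertex G i) ->
    F j (orig G i j) (incidence G i j * q) <= 0.
Proof.
move=> ij ik; have [aj _ _ _ _] := armP ij; have [ak _ _ _ _] := armP ik.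
split=> h phi; last first.
  move=> cphi [dj dk e] mx.
  have E : edge_derive G j phi (vertex G i) = 
     incidence G i j * (incidence G i j * edge_derive G j phi (vertex G i)).
    by rewrite mulrA aj mul1r.
  rewrite E; apply: (h phi) => //.
    by rewrite -E; apply/edge_slopeP.
  have -> : - incidence G i k * (incidence G i j * edge_derive G j phi (vertex G i))
      = edge_derive G k phi (vertex G i); last exact/edge_slopeP.
  rewrite (_ : incidence G i j * _ = - (incidence G i k * edge_derive G k phi (vertex G i))).
    by rewrite mulrNN mulrA ak mul1r.
  by apply/eqP; rewrite -addr_eq0 e.
move=> q cphi /(edge_slopeP _ _ ij)[dj ej] /(edge_slopeP _ _ ik)[dk ek] mx.
rewrite -ej; apply: h => //; split => //.
by rewrite ej ek mulrA mulNr mulrN mulrA aj ak; ring.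
Qed.

(** At an interior point of an edge, a path that runs along the edge at unit speed,
    in the direction given by the sign [a], inherits the condition of the edge. *)
Lemma edge_chart_sub F w g K j t s a : a * a = 1 -> t \in `]0, len G j[ ->
  g s = curve G j t -> 
  (\forall x \near t, g (s + a * (x - t)) = curve G j x) ->
  (forall q, K s q = F j t (a * q)) ->
  edge_sub F w -> chart_sub G g K w s.
Proof.
move=> a2 tl gs gE KE /edge_subP h phi q cphi sl mx.
rewrite KE; apply: (h _ _ phi) => //; last by rewrite -gs.
apply: slope_affine sl => //; last exact: subset_itv_oo_cc tl.
by apply: filterS gE => x /= -> _.
Qed.

Definition continuous_ham F := forall j,
  {within `[0, len G j] `*` setT, continuous (fun z : R * R => F j z.1 z.2)}.

(** Continuity is only available for parameters inside the edge, hence one-sided at a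
    vertex; it is used along an affine path issuing from [t]. *)
Lemma ham_near F j (t a b p eps : R) : continuous_ham F -> t \in `[0, len G j] ->
  0 < eps -> \forall z \near (0 : R, p : R), t + a * z.1 \in `[0, len G j] ->
    F j t (b * p) <= F j (t + a * z.1) (b * z.2) + eps.
Proof.
move=> /(_ j)/subspace_continuousP cF tl e0.
have /cvgrPdist_le/(_ _ e0) := cF (t, b * p) (conj tl Logic.I).
rewrite near_withinE => h.
have c1 : t + a * z.1 @[z --> (0 : R, p : R)] --> t.
  rewrite -[X in _ --> X]addr0 -[X in _ + X](mulr0 a).
  apply: cvgD; first exact: cvg_cst.
  by apply: cvgM; [exact: cvg_cst|exact: cvg_fst].
have c2 : b * z.2 @[z --> (0 : R, p : R)] --> b * p.
  by apply: cvgM; [exact: cvg_cst|exact: cvg_snd].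
have cm := cvg_pair c1 c2.
have : \forall z \near (0 : R, p : R),
    (`[0, len G j] `*` setT) (t + a * z.1, b * z.2) ->
    `|F j t (b * p) - F j (t + a * z.1) (b * z.2)| <= eps.
  exact: (cm _ _ _ _ h).
apply: filterS => z hz zl.
have /= := hz (conj zl Logic.I).
by rewrite ler_norml => /andP[_]; rewrite lerBlDl.
Qed.

Lemma edge_sub_closed F u : continuous_ham F ->
  (forall eta : R, 0 < eta -> exists w L, [/\ continuous_net G w,
     forall y, net_interior G y -> `|w y - u y| <= eta,
     forall j t q, t \in `[0, len G j] -> `|L j t q - F j t q| <= eta &
     edge_sub L w]) ->
  edge_sub F u.
Proof.
move=> cF apx; apply/edge_subP => j t phi d tl cphi sl mx.
have tl' := subset_itv_oo_cc tl.
have /andP[t0 tL] : 0 < t < len G j by move: tl; rewrite in_itv.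
pose r : R := Num.min t (len G j - t) / 2.
have r0 : 0 < r by rewrite divr_gt0// lt_min t0 subr_gt0.
have [rt rl] : r < t /\ r < len G j - t.
  have h : r < Num.min t (len G j - t).
    by rewrite /r ltr_pdivrMr// ltr_pMr ?ltr1n// lt_min t0 subr_gt0.
  by move: h; rewrite lt_min => /andP[].
(* The factor [1] is the direction [a] of the affine form [t + a * s] shared with
   the arms of a vertex. *)
pose g s := curve G j (t + 1 * s).
have gl s : `|s| <= r -> t + 1 * s \in `]0, len G j[.
  by rewrite mul1r ler_norml in_itv/= => /andP[? ?]; apply/andP; split; lra.
have gl' s : s \in `[- r, r] -> t + 1 * s \in `]0, len G j[.
  by rewrite in_itv/= -ler_norml; exact: gl.
have chartg : chart G r g.
  split.
  - apply: comp_within_continuous (@curve_continuous _ _ _ _ G j) _.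
      apply: continuous_subspaceT => s; apply: cvgD; first exact: cvg_cst.
      by apply: cvgM; [exact: cvg_cst|exact: cvg_id].
    by move=> _ [s sr <-]; apply: subset_itv_oo_cc; exact: gl'.
  - move=> x y xr yr /(net_curve_inj (n := G) (j := j)).
    move=> /(_ (subset_itv_oo_cc (gl' _ xr)) (subset_itv_oo_cc (gl' _ yr))).
    by rewrite !mul1r => /addrI.
  - by move=> _ [s sr <-]; apply: open_edge_interior; exact: gl'.
have : chart_sub G g (fun s q => F j (t + 1 * s) (1 * q)) u 0.
  apply: (chart_sub_closed r0 chartg) => [p eps e0|eta eta0].
    have tln : \forall z \near (0 : R, p : R), t + 1 * z.1 \in `[0, len G j].
      have : \forall s \near (0 : R), t + 1 * s \in `[0, len G j].
        have := near_in_itvoo (a := - r) (b := r) (x := 0).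
        rewrite in_itv/= oppr_lt0 r0 => /(_ isT).
        apply: filterS => s /subset_itv_oo_cc sr.
        exact: subset_itv_oo_cc (gl' _ sr).
      exact: cvg_fst.
    move: tln (ham_near 1 1 p cF tl' e0); rewrite mulr0 addr0.
    by apply: filterS2 => z zl; apply.
  have [w [L [cw wu LF tests]]] := apx _ eta0.
  exists w, (fun s q => L j (t + 1 * s) (1 * q)); split => //.
    by move=> s q sr; apply/LF/subset_itv_oo_cc/gl/ltW.
  move=> s sr; apply: edge_chart_sub tests => //.
  - by rewrite mul1r.
  - exact/gl/ltW.
  - by apply: filterE => x; rewrite /g; congr (curve G j _); ring.
move=> /(_ phi d cphi); rewrite /g !mul1r addr0; apply=> //.
rewrite -(mul1r d).
apply: slope_affine sl => //; first by rewrite mul1r.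
have := near_in_itvoo (a := - r) (b := r) (x := 0).
rewrite in_itv/= oppr_lt0 r0 => /(_ isT).
apply: filterS => s sr _; rewrite subr0; split => //.
exact: subset_itv_oo_cc (gl' _ (subset_itv_oo_cc sr)).
Qed.

Lemma junction_sub_closed F u i j k : continuous_ham F ->
  transition G i -> incident G i j -> incident G i k -> j <> k ->
  (forall q, F j (orig G i j) q = F k (orig G i k) q) ->
  (forall q, F j (orig G i j) q = F j (orig G i j) (- q)) ->
  (forall eta : R, 0 < eta -> exists w L, [/\ continuous_net G w,
     forall y, net_interior G y -> `|w y - u y| <= eta,
     forall j t q, t \in `[0, len G j] -> `|L j t q - F j t q| <= eta,
     edge_sub L w & junction_sub L w i j k]) ->
  junction_sub F u i j k.
Proof.
move=> cF ti ij ik jk Fjk Feven apx; apply/junction_subP => // phi d cphi slj slk mx.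
have [aj2 ojl oj ajl [ajoo aj0]] := armP ij.
have [ak2 okl ok akl [akoo ak0]] := armP ik.
have [r [r0 chartg jl kl [joo koo]]] := junction_chartP ti ij ik jk.
have g0 := junction_chart0 k ij.
have gjE s : 0 <= s -> junction_chart G i j k s =
    curve G j (orig G i j + incidence G i j * s) by rewrite /junction_chart => ->.
have gkE s := @junction_chart_npos _ _ _ _ G i j k s ij ik.
set g := junction_chart G i j k in chartg g0 gjE gkE *.
set aj := incidence G i j in slj aj2 ajl ajoo aj0 jl joo gjE *.
set ak := incidence G i k in slk ak2 akl akoo ak0 kl koo gkE *.
set tj := orig G i j in slj ojl oj ajl ajoo aj0 Fjk Feven jl joo gjE *.
set tk := orig G i k in slk okl ok akl akoo ak0 Fjk kl koo gkE *.
(* The Hamiltonian along the chart, its momentum being the slope along the chart. *)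
pose K (M : J -> R -> R -> R) (s q : R) :=
  if 0 <= s then M j (tj + aj * s) (aj * q) else M k (tk + - ak * s) (- ak * q).
have K0 M q : K M 0 q = M j tj (aj * q) by rewrite /K lexx mulr0 addr0.
have nearr : \forall s \near (0 : R), - r <= s <= r.
  have := near_in_itvoo (a := - r) (b := r) (x := 0).
  rewrite in_itv/= oppr_lt0 r0 => /(_ isT).
  by apply: filterS => s; rewrite in_itv/= => /andP[/ltW -> /ltW ->].
have : chart_sub G g (K F) u 0.
  apply: (chart_sub_closed r0 chartg) => [p eps e0|eta eta0].
    have c1 : z.1 @[z --> (0 : R, p : R)] --> (0 : R) by exact: cvg_fst.
    have nearz : \forall z \near (0 : R, p : R), - r <= z.1 <= r by exact: c1 _ nearr.
    (* Both formulas for [K F] agree at the vertex: the signs [aj] and [- ak]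
       are equal or opposite, and the Hamiltonian is even there. *)
    have EK : F j tj (aj * p) = F k tk (- ak * p).
      rewrite -Fjk; have : (aj == ak) || (aj == - ak).
        by rewrite -eqf_sqr !expr2 aj2 ak2.
      by case/orP => /eqP -> //; rewrite mulNr -Feven.
    move: nearz (ham_near aj aj p cF ojl e0) (ham_near (- ak) (- ak) p cF okl e0).
    apply: filterS3 => z /andP[zr1 zr2]; rewrite K0 /K.
    have [z0|z0] := leP 0 z.1; first by move=> h _; apply/h/jl; rewrite z0.
    by move=> _; rewrite -EK => h; apply/h/kl; rewrite zr1 ltW.
  have [w [L [cw wu LF edg jct]]] := apx _ eta0.
  exists w, (K L); split => //.
    move=> s q; rewrite ltr_norml /K => /andP[/ltW s1 /ltW s2].
    have [s0|s0] := leP 0 s; first by apply/LF/jl; rewrite s0.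
    by apply/LF/kl; rewrite s1 ltW.
  move=> s; rewrite ltr_norml => /andP[/ltW s1 /ltW s2].
  have [s0|s0|<-] := ltgtP 0 s.
  - apply: (edge_chart_sub (a := aj) (t := tj + aj * s) (j := j)) edg => //.
    + by apply: joo; rewrite s0.
    + by rewrite gjE ?ltW.
    + apply: filterS (near_affine_gt0 aj (tj + aj * s) s0) => x x0.
      rewrite gjE ?ltW//; congr (curve G j _).
      by ring: aj2.
    + by move=> q; rewrite /K ltW.
  - apply: (edge_chart_sub (a := - ak) (t := tk + - ak * s) (j := k)) edg => //.
    + by rewrite mulrNN.
    + by apply: koo; rewrite s0 s1.
    + by rewrite gkE ?ltW.
    + have s0' : 0 < - s by rewrite oppr_gt0.
      apply: filterS (near_affine_gt0 ak (tk + - ak * s) s0') => x x0.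
      rewrite gkE; last by apply: ltW; rewrite -oppr_gt0 opprD mulNr opprK.
      by congr (curve G k _); ring: ak2.
    + by move=> q; rewrite /K leNgt s0.
  - move=> phi' q cphi' sl' mx'; rewrite K0.
    move/junction_subP : jct => /(_ ij ik phi' q cphi'); apply.
    + apply: slope_affine sl' => //; apply: filterE => x xl; split => //=.
      by rewrite add0r gjE ?aj0// mulrA aj2 mul1r addrC subrK.
    + apply: slope_affine sl' => //; first by rewrite mulrNN.
      apply: filterE => x xl; split => //=.
      have nx : - ak * (x - tk) <= 0 by rewrite mulNr oppr_le0 ak0.
      by rewrite add0r gkE// mulrA mulrNN ak2 mul1r addrC subrK.
    + by rewrite -g0.
move=> /(_ phi d cphi); rewrite K0; apply; last by rewrite g0.
(* The two one-sided slopes of the test function at the vertex agree. *)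
have -> : setT = [set s : R | 0 <= s] `|` [set s : R | s <= 0].
  by apply/seteqP; split => // s _; exact/orP/le_total.
apply: slopeU.
  have -> : d = aj * (aj * d) by rewrite mulrA aj2 mul1r.
  apply: slope_affine slj => //=.
  apply: filterS nearr => s /andP[s1 s2] s0; rewrite subr0; split.
    by apply: jl; rewrite s0.
  by rewrite gjE.
have -> : d = - ak * (- ak * d) by rewrite mulrA mulrNN ak2 mul1r.
apply: slope_affine slk => //=; first by rewrite mulrNN.
apply: filterS nearr => s /andP[s1 s2] s0; rewrite subr0; split.
  by apply: kl; rewrite s1.
by rewrite gkE.
Qed.

End stability.

(** * Duality between subsolutions and supersolutions *)

Section duality.
Context {R : realType} {N : nat} {I J : finType} (G : network R N I J).
Local Notation point := 'rV[R]_N.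
Implicit Types (u w phi : point -> R) (F L : J -> R -> R -> R).

Definition edge_super F w : Prop := forall j x phi,
  open_edge G j x -> continuous_net G phi -> edge_derivable G j phi x ->
  net_local_min G (w \- phi) x ->
  0 <= F j (param G j x) (edge_derive G j phi x).

Definition junction_super F w i j k : Prop := forall phi,
  continuous_net G phi -> jk_differentiable G i j k phi ->
  net_local_min G (w \- phi) (vertex G i) ->
  0 <= F j (param G j (vertex G i)) (edge_derive G j phi (vertex G i)).

Definition dual_ham F : J -> R -> R -> R := fun j t q => - F j t (- q).

Lemma edge_deriveN j phi x : closed_edge G j x -> edge_derivable G j phi x ->
  edge_derivable G j (\- phi) x /\
  edge_derive G j (\- phi) x = - edge_derive G j phi x.
Proof.
move=> jx dphi; apply/edge_slopeP => //.
exact/slopeN/edge_slopeP.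
Qed.

Lemma continuous_netN phi : continuous_net G phi -> continuous_net G (\- phi).
Proof. by move=> cphi x; apply: cvgN; exact: cphi. Qed.

Lemma jk_differentiableN i j k phi : incident G i j -> incident G i k ->
  jk_differentiable G i j k phi -> jk_differentiable G i j k (\- phi).
Proof.
move=> ij ik [dj dk e].
have [dj' ej] := edge_deriveN ij dj; have [dk' ek] := edge_deriveN ik dk.
by split => //; rewrite ej ek !mulrN -opprD e oppr0.
Qed.

Lemma net_local_minN w phi x :
  net_local_min G (w \- phi) x <-> net_local_max G ((\- w) \- (\- phi)) x.
Proof. by split; apply: filterS => y /=; lra. Qed.

(** The test functions of [u] from below are the opposites of those of [- u] from
    above, and their derivatives are opposite too. *)
Lemma edge_super_dual F w : edge_super F w <-> edge_sub G (dual_ham F) (\- w).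
Proof.
split=> h j x phi xj cphi dphi mx.
  have xj' : closed_edge G j x.
    by case: xj => t /subset_itv_oo_cc tl <-; exists t.
  have [d' e'] := edge_deriveN xj' dphi.
  rewrite /dual_ham oppr_le0 -e'; apply: h => //; first exact: continuous_netN.
  apply/net_local_minN; move: mx; apply: filterS => y /=; lra.
have xj' : closed_edge G j x.
  by case: xj => t /subset_itv_oo_cc tl <-; exists t.
have [d' e'] := edge_deriveN xj' dphi.
have := h j x (\- phi) xj (continuous_netN cphi) d'.
by rewrite e' /dual_ham opprK oppr_le0; apply; exact/net_local_minN.
Qed.

Lemma junction_super_dual F w i j k : incident G i j -> incident G i k ->
  junction_super F w i j k <-> junction_sub G (dual_ham F) (\- w) i j k.
Proof.
move=> ij ik; split=> h phi cphi dphi mx; have [dj _ _] := dphi;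
  have [_ e'] := edge_deriveN ij dj.
  rewrite /dual_ham oppr_le0 -e'; apply: h.
  - exact: continuous_netN.
  - exact: jk_differentiableN.
  - apply/net_local_minN; move: mx; apply: filterS => y /=; lra.
have := h (\- phi) (continuous_netN cphi) (jk_differentiableN ij ik dphi).
by rewrite e' /dual_ham opprK oppr_le0; apply; exact/net_local_minN.
Qed.

Lemma continuous_dual_ham F : continuous_ham G F -> continuous_ham G (dual_ham F).
Proof.
move=> cF j; have c : continuous (fun z : R * R => (z.1, - z.2)).
  move=> z; have c1 : y.1 @[y --> z] --> z.1 by exact: cvg_fst.
  have c2 : - y.2 @[y --> z] --> - z.2 by apply: cvgN; exact: cvg_snd.
  exact: cvg_pair c1 c2.
have h : {within `[0, len G j] `*` setT, continuous (fun z : R * R => F j z.1 (- z.2))}.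
  have c0 : {within `[0, len G j] `*` setT, continuous (fun z : R * R => (z.1, - z.2))} by exact: continuous_subspaceT.
  apply: (comp_within_continuous c0 (cF j)).
  by move=> _ [z [z1 _] <-].
by move=> z; apply: cvgN; exact: h.
Qed.

End duality.

(** * Stability of viscosity solutions *)

Theorem proposition3p2 (R : realType) (N : nat) (I J : finType)
    (G : network R N I J)
    (H : J -> R -> R -> R) (Hn : nat -> J -> R -> R -> R)
    (un : nat -> 'rV[R]_N -> R) (u : 'rV[R]_N -> R)
    (eikH : eikonal_type G H) (eikHn : forall n : nat, eikonal_type G (Hn n))
    (cvgH : forall j : J,
      {uniform closed_edge G j `*` [set: R],
        (fun (n : nat) (z : 'rV[R]_N * R) => Hn n j (param G j z.1) z.2) @ \oo
          --> (fun z : 'rV[R]_N * R => H j (param G j z.1) z.2)})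
    (solun : forall n : nat, viscosity_solution G (Hn n) (un n))
    (cvgu : {uniform net_interior G, un @ \oo --> u}) :
  viscosity_solution G H u.
Proof.
have [cH _ _ compH evenH] := eikH.
have close (eta : R) : 0 < eta -> \forall n \near \oo,
    (forall y, net_interior G y -> `|un n y - u y| <= eta) /\
    (forall j t q, t \in `[0, len G j] -> `|Hn n j t q - H j t q| <= eta).
  move=> eta0; have hu := uniform_near cvgu eta0.
  have hH : \forall n \near \oo, forall j z, (closed_edge G j `*` setT) z ->
      `|Hn n j (param G j z.1) z.2 - H j (param G j z.1) z.2| <= eta.
    by apply: filter_forall => j; exact: uniform_near (cvgH j) eta eta0.
  apply: filterS2 hu hH => n hu hH; split => // j t q tl.
  have := hH j (curve G j t, q); rewrite /= param_curve//; apply.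
  by split => //=; exists t.
have cdH := continuous_dual_ham cH.
have closeD (eta : R) : 0 < eta -> \forall n \near \oo,
    (forall y, net_interior G y -> `|(\- un n) y - (\- u) y| <= eta) /\
    (forall j t q, t \in `[0, len G j] ->
       `|dual_ham (Hn n) j t q - dual_ham H j t q| <= eta).
  move=> /close; apply: filterS => n [hu hH]; split => [y /hu|j t q tl].
    by rewrite /= -opprD normrN.
  by rewrite /dual_ham -opprD normrN hH.
have cun n : continuous_net G (un n) by have [] := solun n.
have eun n : edge_sub G (Hn n) (un n) by have [_ []] := solun n.
have edun n : edge_sub G (dual_ham (Hn n)) (\- un n).
  by have [_ _ [+ _]] := solun n; move/edge_super_dual.
split; [|split|split].
- apply: (@uniform_limit_continuous_subspace _ _ _ (un @ \oo)) cvgu => //.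
  by exists 0%N => // n _; exact: cun.
- apply: (edge_sub_closed cH) => eta /close /filter_ex[n [hu hH]].
  by exists (un n), (Hn n).
- move=> i j k phi ti ij ik jk; move: phi.
  apply: (junction_sub_closed cH) => //.
  + by move=> q; apply: compH.
  + by move=> q; apply: evenH.
  move=> eta /close /filter_ex[n [hu hH]]; exists (un n), (Hn n); split => //.
  by move=> phi; have [_ [_ jun] _] := solun n; apply: jun.
- apply/edge_super_dual/(edge_sub_closed cdH) => eta /closeD /filter_ex[n [hu hH]].
  by exists (\- un n), (dual_ham (Hn n)); split => //; exact: continuous_netN.
- move=> i j ti ij.
  (* The second arm may change with [n]; keep one that occurs infinitely often. *)
  have /frequently_finite[k hk] : forall n, exists k,
      [/\ incident G i k, k <> j & junction_super G (Hn n) (un n) i j k].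
    by move=> n; have [_ _ [_ +]] := solun n => /(_ i j ti ij).
  have [_ [_ [ik kj _]]] := hk _ (@filterT _ \oo _).
  exists k; split => //; apply/junction_super_dual => //.
  apply: (junction_sub_closed cdH) => //.
  + by move=> /esym.
  + by move=> q; rewrite /dual_ham/orig (compH i j k).
  + by move=> q; rewrite /dual_ham opprK/orig -evenH.
  move=> eta /closeD /hk[n [[hu hH] [_ _ jun]]].
  exists (\- un n), (dual_ham (Hn n)); split => //; first exact: continuous_netN.
  exact/junction_super_dual.
Qed.
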